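(* Let $x>0$ be real, $b$ complex and $z\neq 0$ complex. Then $$\frac{z^{x}}{\Gamma(b+x)}=\sum_{n=1}^{\infty}\mu(n)\left(E_{nx,b}\left(z^{nx}\right)-\frac{1}{\Gamma(b)}\right).$$ Equivalently, with $y=z^{x}$, $\frac{y}{\Gamma(b+x)}=\sum_{n=1}^{\infty}\mu(n)\left(E_{nx,b}(y^{n})-\frac{1}{\Gamma(b)}\right)$.
   Context: The Mittag-Leffler function is $E_{a,b}(z)=\sum_{k=0}^{\infty}\frac{z^{k}}{\Gamma(b+ak)}$ for $\operatorname{Re}(a)>0$, with $1/\Gamma$ the entire reciprocal Gamma function. $\mu$ is the Möbius function. Powers are $z^{c}=e^{c\log z}$ with the same fixed value of $\log z$ throughout. *)

(* Defs.v *)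
(* Complex numbers, limits and series are those of Coquelicot over Stdlib's R;
   only the prime factorisation of natural numbers is taken from MathComp. *)
From mathcomp Require Import ssreflect ssrbool eqtype ssrnat seq prime.
From Stdlib Require Import Reals Factorial.
From Coquelicot Require Import Coquelicot.

Open Scope R_scope.
Open Scope C_scope.

(* The target is fixed explicitly: C also carries real normed-module
   structures, which unification could otherwise pick. *)
Definition is_Cseries (u : nat -> C) (l : C) : Prop :=
  @is_series C_AbsRing C_NormedModule u l.

(* As usual with iota, the next two values are meaningful only when the limit,
   respectively the sum, exists. *)
Definition Clim_seq (u : nat -> C) : C :=
  @iota (CompleteNormedModule.CompleteSpace C_AbsRing C_CompleteNormedModule)
    (fun l => filterlim u eventually (@locally C_UniformSpace l)).

Definition Cseries (u : nat -> C) : C :=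
  @iota (CompleteNormedModule.CompleteSpace C_AbsRing C_CompleteNormedModule) (is_Cseries u).

Definition Cexp (z : C) : C :=
  (exp (Re z) * cos (Im z), exp (Re z) * sin (Im z))%R.

(* The power z^c determined by a chosen logarithm logz of z. *)
Definition Cpower_log (logz c : C) : C := Cexp (c * logz).

Fixpoint rising (s : C) (n : nat) : C :=
  match n with
  | O => RtoC 1
  | S m => rising s m * (s + INR m)
  end.

(* Gauss's formula
     1 / Gamma(s) = lim_n  s (s + 1) ... (s + n) / (n! n^s),
   where n^s = exp (s ln n). The limit exists for every complex s and is 0
   exactly at s = 0, -1, -2, ..., so this is the entire reciprocal Gamma
   function (the term n = 0, where Stdlib's ln 0 = 0, does not matter). *)
Definition rGamma (s : C) : C :=
  Clim_seq (fun n : nat =>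
    rising s (S n) / (INR (fact n) * Cexp (s * ln (INR n)))).

(* For Re a > 0 the series converges for every b and z. *)
Definition MittagLeffler (a b z : C) : C :=
  Cseries (fun k : nat => z ^ k * rGamma (b + a * INR k)).

(* The value at n = 0 is irrelevant (it is 1). *)
Definition mobius (n : nat) : R :=
  if all (fun p : nat => logn p n == 1%nat) (primes n)
  then ((-1) ^ size (primes n))%R
  else 0%R.

(* Main.v *)
Require Import Defs.
From HB Require Import structures.
From mathcomp Require Import ssreflect ssrfun ssrbool eqtype ssrnat seq div prime bigop.
From Stdlib Require Import Reals Factorial Lra.
From Coquelicot Require Import Coquelicot.

Open Scope R_scope.
Open Scope C_scope.

(** Put [g m = y ^ m / Gamma (b + m x)]. Removing the term [k = 0] from the
    Mittag-Leffler series leaves [E_(nx,b) (y ^ n) - 1 / Gamma b], which is the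
    sum of [g (n k)] over [k >= 1]. Hence the right-hand side is the double sum
    of [mu n * g (n k)]; collecting the terms with [n k = m] gives the sum over
    [m] of [g m] times the sum of [mu n] over the divisors [n] of [m], and the
    latter vanishes unless [m = 1]. Only [g 1] remains. The choice of [log z]
    enters only through [z ^ (n x) = y ^ n].

    The rearrangement ([mobius_series_inversion]) is carried out on finite
    sums. For fixed [N], the sum over [n <= N] is the limit in [L] of the sums
    restricted to [n k <= L]. There the coefficient of [g m] is exact for
    [m <= N] and at most [N < m] in modulus for the other [m], so the error is
    at most the tail of the series of [m * |g m|].

    What remains is that this series converges, which needs the decay of
    [1 / Gamma (b + m x)] in [m] ([rGamma_decay]). It is read off Gauss's
    product. The quotient of consecutive terms of Gauss's sequence is
    [1 + O (1 / n - 1 / (n + 1))] uniformly for bounded [s]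
    ([Gauss_ratio_bound]); so the sequence converges, and the limit is bounded
    on bounded sets ([is_Clim_rGamma], [rGamma_bound]). The recurrence
    [1 / Gamma s = s / Gamma (s + 1)] ([rGammaS]) carries the bound from the
    strip [1 <= Re s < 2] to the right, with a gain of [n!] after [n] steps
    ([rGamma_shift_bound]), and [n!] beats every geometric sequence. *)

(** * Limits and series of complex numbers *)

(** The uniform structure is named so that the limit unfolds to the one
    behind [Clim_seq] and [is_Cseries]. *)
Definition is_Clim (u : nat -> C) (l : C) : Prop :=
  filterlim u eventually (@locally C_UniformSpace l).

(** Balls of the product uniform structure and of the modulus define the same
    filter; through this lemma all estimates become real ones. *)
Lemma is_Clim_Cmod (u : nat -> C) (l : C) :
  is_Clim u l <-> is_lim_seq (fun n => Cmod (u n - l)) 0%R.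
Proof.
rewrite /is_Clim.
rewrite (@filterlim_locally_ball_norm C_AbsRing nat C_NormedModule eventually _ u l).
rewrite -is_lim_seq_spec /is_lim_seq' /ball_norm.
split=> H eps; have [N HN] := H eps; exists N => n /HN;
  rewrite Rminus_0_r Rabs_pos_eq //; exact: Cmod_ge_0.
Qed.

Lemma is_Clim_unique (u : nat -> C) (l1 l2 : C) :
  is_Clim u l1 -> is_Clim u l2 -> l1 = l2.
Proof.
exact: (@filterlim_locally_unique nat C_AbsRing C_NormedModule eventually _ u).
Qed.

Lemma Clim_seq_unique (u : nat -> C) (l : C) : is_Clim u l -> Clim_seq u = l.
Proof.
move=> H.
apply: (@iota_unique C_AbsRing C_CompleteNormedModule
  (fun l => filterlim u eventually (@locally C_UniformSpace l)) l) => // y Hy.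
exact: is_Clim_unique Hy H.
Qed.

Lemma Cseries_unique (u : nat -> C) (l : C) : is_Cseries u l -> Cseries u = l.
Proof.
move=> H.
apply: (@iota_unique C_AbsRing C_CompleteNormedModule (is_Cseries u) l) => // y Hy.
exact: is_Clim_unique Hy H.
Qed.

Lemma is_Clim_const (c : C) : is_Clim (fun _ => c) c.
Proof. exact: filterlim_const. Qed.

Lemma is_Clim_plus (u v : nat -> C) (k l : C) :
  is_Clim u k -> is_Clim v l -> is_Clim (fun n => u n + v n) (k + l).
Proof.
move=> Hu Hv; apply: filterlim_comp_2 Hu Hv _.
exact: (@filterlim_plus C_AbsRing C_NormedModule).
Qed.

Lemma is_Clim_scal (c : C) (u : nat -> C) (l : C) :
  is_Clim u l -> is_Clim (fun n => c * u n) (c * l).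
Proof.
move=> Hu; apply: filterlim_comp Hu _.
exact: (@filterlim_scal_r C_AbsRing C_NormedModule).
Qed.

Lemma is_Clim_Cmod_le (u : nat -> C) (l : C) (B : R) (N : nat) :
  is_Clim u l -> (forall n, (N <= n)%coq_nat -> (Cmod (u n) <= B)%R) -> (Cmod l <= B)%R.
Proof.
move=> /is_Clim_Cmod Hu HB.
suff: Rbar_le (Cmod l) (B + 0)%R by rewrite /= Rplus_0_r.
apply: (@is_lim_seq_le_loc (fun _ => Cmod l) (fun n => B + Cmod (u n - l))%R).
- exists N => n Hn.
  have := Cmod_triangle (u n) (- (u n - l)); rewrite Cmod_opp.
  have -> : u n + - (u n - l) = l by ring.
  have := HB n Hn; lra.
- exact: is_lim_seq_const.
- by apply: is_lim_seq_plus'; [exact: is_lim_seq_const|].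
Qed.

Lemma ex_Cseries_le (u : nat -> C) (v : nat -> R) :
  (forall n, (Cmod (u n) <= v n)%R) -> ex_series v -> exists l, is_Cseries u l.
Proof.
by move=> Huv; apply: (@ex_series_le C_AbsRing C_CompleteNormedModule) => n; apply: Huv.
Qed.

Lemma is_Clim_incr_1 (u : nat -> C) (l : C) :
  is_Clim u l <-> is_Clim (fun n => u (S n)) l.
Proof.
split=> /is_Clim_Cmod H; apply/is_Clim_Cmod.
- exact: (is_lim_seq_incr_1 (fun n => Cmod (u n - l)) _).1.
- exact: (is_lim_seq_incr_1 (fun n => Cmod (u n - l)) _).2.
Qed.

Lemma is_lim_seq_inv_S : is_lim_seq (fun n => / INR (S n))%R 0%R.
Proof.
apply: (is_lim_seq_incr_1 (fun n => / INR n)%R _).1.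
have -> : (Finite 0) = Rbar_inv p_infty by [].
exact: is_lim_seq_inv is_lim_seq_INR _.
Qed.

(** The increments are summable because their bounds telescope. *)
Lemma is_Clim_telescope (u : nat -> C) (v : nat -> R) :
  (forall n, (Cmod (u (S n) - u n) <= v n - v (S n))%R) ->
  is_lim_seq v 0%R -> exists l, is_Clim u l.
Proof.
move=> Huv Hv.
have [] := ex_Cseries_le (fun n => u (S n) - u n) (fun n => v n - v (S n))%R Huv.
  exists (v 0%nat).
  change (is_lim_seq (sum_n (fun n => v n - v (S n))%R) (v 0%nat)).
  apply: (is_lim_seq_ext (fun n => v 0%nat - v (S n))%R).
    elim=> [|n IH]; first by rewrite sum_O.
    by rewrite sum_Sn -IH /plus /=; ring.
  rewrite -{2}(Rminus_0_r (v 0%nat)).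
  apply: is_lim_seq_minus'; [exact: is_lim_seq_const|].
  exact/(is_lim_seq_incr_1 v).
move=> l Hl; exists (u 0%nat + l); apply/is_Clim_incr_1.
apply: (filterlim_ext (fun n => u 0%nat + sum_n (fun n => u (S n) - u n) n)); last first.
  by apply: is_Clim_plus (is_Clim_const _) _; exact: Hl.
elim=> [|n IH]; first by rewrite sum_O; ring.
rewrite sum_Sn; change (plus ?x ?y) with (x + y); rewrite Cplus_assoc IH; ring.
Qed.

(** * The complex exponential *)

Lemma Cexp_plus (u v : C) : Cexp (u + v) = Cexp u * Cexp v.
Proof.
case: u v => [a c] [a' c']; rewrite /Cexp /Cmult /= exp_plus cos_plus sin_plus.
congr pair; ring.
Qed.

Lemma Cexp_0 : Cexp 0 = 1.
Proof. by rewrite /Cexp /= exp_0 cos_0 sin_0 Rmult_1_l Rmult_0_r. Qed.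

Lemma Cexp_neq_0 (u : C) : Cexp u <> 0.
Proof.
move=> H; have := Cexp_plus u (- u).
have -> : u + - u = 0 by ring.
rewrite Cexp_0 H Cmult_0_l => /(f_equal fst) /=; lra.
Qed.

Lemma Cexp_pow (u : C) (n : nat) : Cexp (INR n * u) = Cexp u ^ n.
Proof.
elim: n => [|n IH]; first by rewrite /= Cmult_0_l Cexp_0.
rewrite S_INR RtoC_plus Cmult_plus_distr_r Cexp_plus IH Cmult_1_l /=; ring.
Qed.

Lemma sq_Rabs (x : R) : (x ^ 2 = Rabs x * Rabs x)%R.
Proof. by rewrite -Rabs_mult Rabs_pos_eq /=; [ring|have := pow2_ge_0 x; lra]. Qed.

(** The four real estimates below bound the real and imaginary parts of
    [Cexp w - 1 - w]. *)
Lemma exp_sub1_bound (x : R) : (Rabs (exp x - 1) <= Rabs x * exp (Rabs x))%R.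
Proof.
have H1 := exp_ineq1_le x; have H2 := exp_ineq1_le (- x).
have H3 : (exp x * exp (- x) = 1)%R by rewrite -exp_plus Rplus_opp_r exp_0.
have Hp := exp_pos x.
case: (Rle_dec 0 x) => Hx.
- rewrite (Rabs_pos_eq x) // Rabs_pos_eq; nra.
- rewrite (Rabs_left x) ?Rabs_left1; [nra|nra|lra].
Qed.

Lemma exp_sub1_sub_bound (x : R) :
  (Rabs (exp x - 1 - x) <= x ^ 2 * exp (Rabs x))%R.
Proof.
have H1 := exp_ineq1_le x; have H2 := exp_ineq1_le (- x).
have H3 : (exp x * exp (- x) = 1)%R by rewrite -exp_plus Rplus_opp_r exp_0.
have Hp := exp_pos x.
(* Multiply 1 - x <= exp (- x) by exp x. *)
have H4 : (exp x - 1 <= x * exp x)%R by nra.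
rewrite Rabs_pos_eq; last lra.
apply: (Rle_trans _ (x * (exp x - 1))); first lra.
have := exp_sub1_bound x; have := Rabs_pos x.
have := Rle_abs (x * (exp x - 1)); rewrite Rabs_mult.
rewrite sq_Rabs.
nra.
Qed.

Lemma cos_sub1_bound (y : R) : (0 <= 1 - cos y <= Rabs y)%R /\ (1 - cos y <= y ^ 2)%R.
Proof.
have Hs : (Rabs (sin (y / 2)) <= Rabs (y / 2))%R.
  have P : forall t : R, (0 < t -> Rabs (sin t) <= t)%R.
    move=> t Ht; apply: Rabs_le; have := sin_lt_x t Ht.
    split; last lra.
    case: (Rle_dec t PI) => Hp; first by have := sin_ge_0 t ltac:(lra) Hp; lra.
    have := SIN_bound t; have := PI2_1; lra.
  case: (Rtotal_order (y / 2) 0) => [H|[->|H]].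
  - by rewrite -Rabs_Ropp -sin_neg -(Rabs_Ropp (y / 2)) (Rabs_pos_eq (- _)); [apply: P; lra|lra].
  - rewrite sin_0; exact: Rle_refl.
  - by rewrite (Rabs_pos_eq (y / 2)); [apply: P|lra].
(* Half-angle formula: both bounds follow from |sin (y/2)| <= |y/2|. *)
have E : (1 - cos y = 2 * (Rabs (sin (y / 2)) * Rabs (sin (y / 2))))%R.
  have -> : cos y = cos (2 * (y / 2)) by congr cos; field.
  rewrite cos_2a_sin -sq_Rabs; ring.
have B : (Rabs (sin (y / 2)) <= 1)%R by apply: Rabs_le; have := SIN_bound (y / 2); lra.
have P := Rabs_pos (sin (y / 2)).
have Ey : (Rabs (y / 2) = Rabs y / 2)%R.
  by rewrite /Rdiv Rabs_mult (Rabs_pos_eq (/ 2)); lra.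
have Ey2 := sq_Rabs y.
have Py := Rabs_pos y.
rewrite Ey in Hs; rewrite E Ey2; split; [split|]; nra.
Qed.

Lemma sin_sub_bound (y : R) : (Rabs (sin y - y) <= y ^ 2)%R.
Proof.
have Ey2 := sq_Rabs y.
(* The mean value theorem for sin t - t, whose derivative cos t - 1 is at most
   |t| in modulus. *)
have [c [Hc1 Hc2]] := MVT_gen (fun t => sin t - t)%R 0 y (fun t => cos t - 1)%R
  ltac:(by move=> t _; auto_derive; [|ring])
  ltac:(by move=> t _; apply: continuity_pt_minus; [apply: continuity_sin|apply: continuity_pt_id]).
have -> : (sin y - y = (cos c - 1) * y)%R by rewrite sin_0 in Hc2; lra.
rewrite Rabs_mult Ey2; apply: Rmult_le_compat_r; first exact: Rabs_pos.
have [[H1 H2] _] := cos_sub1_bound c.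
rewrite Rabs_minus_sym Rabs_pos_eq //; apply: Rle_trans H2 _.
move: Hc1; rewrite /Rmin /Rmax; case: Rle_dec => Hy Hc.
- rewrite !Rabs_pos_eq; lra.
- rewrite !Rabs_left1; lra.
Qed.

Lemma Cmod_le_Rabs_plus (a c : R) : (Cmod (a, c) <= Rabs a + Rabs c)%R.
Proof.
have Ha := Rabs_pos a; have Hc := Rabs_pos c.
apply: Rsqr_incr_0_var; last lra.
have P1 := pow2_ge_0 a; have P2 := pow2_ge_0 c.
rewrite /Cmod Rsqr_sqrt; last by simpl fst; simpl snd; lra.
rewrite /fst /snd !sq_Rabs /Rsqr; nra.
Qed.

(** With [w = x + i y], the real part is
    [e^x (cos y - 1) + (e^x - 1 - x)] and the imaginary part is
    [e^x (sin y - y) + (e^x - 1) y]; each summand is at most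
    [|w|^2 exp |w|]. *)
Lemma Cexp_sub1_sub_bound (w : C) :
  (Cmod (Cexp w - 1 - w) <= 5 * Cmod w ^ 2 * exp (Cmod w))%R.
Proof.
have := Rmax_Cmod w; move: (Cmod w) (Cmod_ge_0 w) => r Hr.
case: w => x y /= Hm.
have Hx : (Rabs x <= r)%R by have := Rmax_l (Rabs x) (Rabs y); lra.
have Hy : (Rabs y <= r)%R by have := Rmax_r (Rabs x) (Rabs y); lra.
have exp_le : forall u v : R, (u <= v -> exp u <= exp v)%R.
  by move=> u v [/exp_increasing|->]; lra.
have He := exp_le _ _ Hx.
have He' : (exp x <= exp r)%R by apply: exp_le; have := Rle_abs x; lra.
have Hp := exp_pos x; have Hpr : (1 <= exp r)%R by have := exp_ineq1_le r; lra.
have Hax := Rabs_pos x; have Hay := Rabs_pos y.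
have sq_le : forall t : R, (Rabs t <= r -> t ^ 2 <= r * r)%R.
  by move=> t Ht; rewrite sq_Rabs; have := Rabs_pos t; nra.
have rr : (0 <= r * r)%R by nra.
have E1 : (Rabs (exp x * (cos y - 1)) <= r * r * exp r)%R.
  rewrite Rabs_mult (Rabs_pos_eq (exp x)); last lra.
  have [[H1 _] H2] := cos_sub1_bound y.
  rewrite Rabs_minus_sym (Rabs_pos_eq (1 - cos y)) //.
  have := sq_le _ Hy; nra.
have E2 : (Rabs (exp x - 1 - x) <= r * r * exp r)%R.
  have := exp_sub1_sub_bound x; have := sq_le _ Hx; have := exp_pos (Rabs x); nra.
have E3 : (Rabs (exp x * (sin y - y)) <= r * r * exp r)%R.
  rewrite Rabs_mult (Rabs_pos_eq (exp x)); last lra.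
  have := sin_sub_bound y; have := sq_le _ Hy; have := Rabs_pos (sin y - y); nra.
have E4 : (Rabs ((exp x - 1) * y) <= r * r * exp r)%R.
  rewrite Rabs_mult; have := exp_sub1_bound x; have := Rabs_pos (exp x - 1).
  have := exp_pos (Rabs x) => P1 P2 P3.
  have P4 : (Rabs (exp x - 1) <= r * exp r)%R by nra.
  nra.
have -> : Cexp (x, y) - 1 - (x, y)
  = (exp x * (cos y - 1) + (exp x - 1 - x), exp x * (sin y - y) + (exp x - 1) * y)%R.
  by rewrite /Cexp /Cminus /Cplus /Copp /=; congr pair; ring.
apply: Rle_trans (Cmod_le_Rabs_plus _ _) _.
have := Rabs_triang (exp x * (cos y - 1)) (exp x - 1 - x).
have := Rabs_triang (exp x * (sin y - y)) ((exp x - 1) * y).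
nra.
Qed.

(** * Gauss's product for the reciprocal Gamma function *)

Definition Gauss_term (s : C) (n : nat) : C :=
  rising s (S n) / (INR (fact n) * Cexp (s * ln (INR n))).

(** The quotient of the terms [n + 1] and [n] of Gauss's sequence,
    [(1 + s / (n + 1)) (n / (n + 1))^s]. *)
Definition Gauss_ratio (s : C) (n : nat) : C :=
  (1 + s * / INR (S n)) * Cexp (- (s * (ln (INR (S n)) - ln (INR n)))).

Lemma RtoC_INR_neq_0 (n : nat) : (0 < n)%nat -> RtoC (INR n) <> 0.
Proof. by case: n => // n _ /RtoC_inj; have := pos_INR n; rewrite S_INR; lra. Qed.

Lemma Gauss_termS (s : C) (n : nat) :
  Gauss_term s (S n) = Gauss_term s n * Gauss_ratio s n.
Proof.
rewrite /Gauss_term /Gauss_ratio.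
have -> : rising s (S (S n)) = rising s (S n) * (s + INR (S n)) by [].
have -> : fact (S n) = Nat.mul (S n) (fact n) by [].
move: (rising s (S n)) => r; rewrite mult_INR RtoC_mult.
have HS : RtoC (INR (S n)) <> 0 by exact: RtoC_INR_neq_0.
have Hf : RtoC (INR (fact n)) <> 0 by move=> /RtoC_inj; exact: INR_fact_neq_0.
have -> : Cexp (s * ln (INR (S n)))
        = Cexp (s * ln (INR n)) / Cexp (- (s * (ln (INR (S n)) - ln (INR n)))).
  rewrite -(Cmult_1_r (Cexp (s * ln (INR (S n))))).
  rewrite -(Cinv_r _ (Cexp_neq_0 (- (s * (ln (INR (S n)) - ln (INR n)))))) Cmult_assoc.
  by rewrite -Cexp_plus; congr (Cexp _ / _); ring.
have Ha := Cexp_neq_0 (s * ln (INR n)).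
have Hb := Cexp_neq_0 (- (s * (ln (INR (S n)) - ln (INR n)))).
by field.
Qed.

(** Both bounds are [ln t <= t - 1], at [t = n / (n + 1)] and at
    [t = (n + 1) / n]. *)
Lemma ln_succ_bounds (n : nat) : (0 < n)%nat ->
  (/ INR (S n) <= ln (INR (S n)) - ln (INR n) <= / INR n)%R.
Proof.
case: n => // n _.
have Hp : (0 < INR (S n))%R by have := pos_INR n; rewrite S_INR; lra.
have Hq : (0 < INR (S (S n)))%R by rewrite S_INR; lra.
have E : INR (S (S n)) = (INR (S n) + 1)%R by rewrite S_INR.
have key : forall t : R, (0 < t -> ln t <= t - 1)%R.
  by move=> t Ht; have := exp_ineq1_le (ln t); rewrite exp_ln //; lra.
split.
- have := key (INR (S n) / INR (S (S n)))%R ltac:(exact: Rdiv_lt_0_compat).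
  rewrite ln_div // => H.
  have : (INR (S n) / INR (S (S n)) - 1 = - / INR (S (S n)))%R by rewrite E; field; lra.
  lra.
- have := key (INR (S (S n)) / INR (S n))%R ltac:(exact: Rdiv_lt_0_compat).
  rewrite ln_div // => H.
  have : (INR (S (S n)) / INR (S n) - 1 = / INR (S n))%R by rewrite E; field; lra.
  lra.
Qed.

Definition Gauss_const (M : R) : R := (10 * M ^ 2 * (1 + M) * exp M + M + M ^ 2)%R.

(** Let [u = 1 / (n + 1)], [v = 1 / n] and [l = ln (1 + 1 / n)], so that
    [u <= l <= v] and [v - u = u v]. If [e] is the second-order remainder of
    the exponential at [- s l], the difference is
    [(1 + s u) e + s (u - l) - s^2 u l], and every summand is [O (u v)].
    Bounding by [v - u] rather than by [1 / n^2] makes the sums over [n]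
    telescope. *)
Lemma Gauss_ratio_bound (M : R) (s : C) (n : nat) : (Cmod s <= M)%R -> (0 < n)%nat ->
  (Cmod (Gauss_ratio s n - 1) <= Gauss_const M * (/ INR n - / INR (S n)))%R.
Proof.
move=> HM Hn; have [L1 L2] := ln_succ_bounds n Hn.
have H1 : (1 <= INR n)%R by move: Hn => /leP /le_INR.
have E : INR (S n) = (INR n + 1)%R by rewrite S_INR.
rewrite /Gauss_ratio -RtoC_minus -RtoC_inv; last lra.
move: L1 L2.
set l := (ln (INR (S n)) - ln (INR n))%R; set u := (/ INR (S n))%R.
set v := (/ INR n)%R => L1 L2.
have Hu : (0 < u)%R by apply: Rinv_0_lt_compat; lra.
have Huv : (v - u = u * v)%R by rewrite /u /v E; field; lra.
have Hv1 : (v <= 1)%R by rewrite /v -Rinv_1; apply: Rinv_le_contravar; lra.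
have Huv2 : (v <= 2 * u)%R by nra.
have Hu1 : (u <= 1)%R by lra.
set m := Cmod s in HM *; have Hm : (0 <= m)%R by exact: Cmod_ge_0.
have Hsl : Cmod (- (s * l)) = (m * l)%R.
  by rewrite Cmod_opp Cmod_mult Cmod_R Rabs_pos_eq //; lra.
have HT := Cexp_sub1_sub_bound (- (s * l)); rewrite Hsl in HT.
set e := Cexp _ - 1 - _ in HT.
have -> : (1 + s * u) * Cexp (- (s * l)) - 1
  = (1 + s * u) * e + (s * (u - l)%R - s * s * (u * l)%R).
  by rewrite /e RtoC_minus RtoC_mult; ring.
have B1 : (Cmod (1 + s * u) <= 1 + M)%R.
  apply: Rle_trans (Cmod_triangle _ _) _.
  rewrite Cmod_1 Cmod_mult Cmod_R Rabs_pos_eq -/m; last lra.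
  have : (m * u <= M * 1)%R by apply: Rmult_le_compat; lra.
  lra.
have lv : (l ^ 2 <= 2 * (u * v))%R by nra.
have B2 : (Cmod e <= 10 * M ^ 2 * exp M * (u * v))%R.
  apply: Rle_trans HT _.
  have He : (exp (m * l) <= exp M)%R.
    have [/exp_increasing|->] : (m * l <= M)%R by nra.
      lra.
    lra.
  have Hp := exp_pos (m * l).
  have sq : (m ^ 2 <= M ^ 2)%R by nra.
  have H2 : ((m * l) ^ 2 <= 2 * M ^ 2 * (u * v))%R.
    have -> : ((m * l) ^ 2 = m ^ 2 * l ^ 2)%R by ring.
    have := pow2_ge_0 m; have := pow2_ge_0 l; nra.
  have := pow2_ge_0 (m * l); nra.
have B3 : (Cmod (s * (u - l)%R) <= M * (u * v))%R.
  rewrite Cmod_mult Cmod_R Rabs_left1 -/m; [nra|lra].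
have B4 : (Cmod (s * s * (u * l)%R) <= M ^ 2 * (u * v))%R.
  rewrite !Cmod_mult Cmod_R Rabs_pos_eq -/m; last nra.
  have mm : (m * m <= M ^ 2)%R by nra.
  have ul : (0 <= u * l <= u * v)%R by nra.
  nra.
rewrite Huv /Gauss_const.
apply: Rle_trans (Cmod_triangle _ _) _.
have := Cmod_triangle (s * (u - l)%R) (- (s * s * (u * l)%R)).
rewrite Cmod_opp => T2.
have B5 : (Cmod ((1 + s * u) * e) <= (1 + M) * (10 * M ^ 2 * exp M * (u * v)))%R.
  rewrite Cmod_mult; apply: Rmult_le_compat => //; exact: Cmod_ge_0.
rewrite /Cminus; lra.
Qed.

Lemma Gauss_const_ge_0 (M : R) : (0 <= M)%R -> (0 <= Gauss_const M)%R.
Proof.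
move=> HM; rewrite /Gauss_const; have := exp_pos M => HE.
have H2 := pow2_ge_0 M.
have : (0 <= 10 * M ^ 2 * (1 + M) * exp M)%R.
  by apply: Rmult_le_pos; [apply: Rmult_le_pos|]; lra.
lra.
Qed.

(** With [K = Gauss_const M], a step multiplies the modulus by at most
    [1 + K (1 / n - 1 / (n + 1)) <= exp (K / n) / exp (K / (n + 1))], so the
    modulus times [exp (K / n)] does not increase; at [n = 1] the Gauss term is
    [s (s + 1)]. *)
Lemma Gauss_term_bound (M : R) (s : C) (n : nat) : (Cmod s <= M)%R -> (0 < n)%nat ->
  (Cmod (Gauss_term s n) <= M * (M + 1) * exp (Gauss_const M))%R.
Proof.
move=> HM; have HM0 : (0 <= M)%R by have := Cmod_ge_0 s; lra.
have HK := Gauss_const_ge_0 M HM0; set K := Gauss_const M.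
move=> Hn.
suff: (Cmod (Gauss_term s n) * exp (K * / INR n) <= M * (M + 1) * exp K)%R.
  have : (1 <= exp (K * / INR n))%R.
    have := exp_ineq1_le (K * / INR n).
    suff: (0 <= K * / INR n)%R by lra.
    apply: Rmult_le_pos => //; apply: Rlt_le; apply: Rinv_0_lt_compat.
    by apply: lt_0_INR; apply/ltP.
  have := Cmod_ge_0 (Gauss_term s n); nra.
case: n Hn => // n _; elim: n => [|n IH].
- rewrite Rinv_1 Rmult_1_r; apply: Rmult_le_compat_r; first exact: Rlt_le (exp_pos K).
  have -> : Gauss_term s 1 = s * (s + 1).
    rewrite /Gauss_term /= ln_1 Cmult_0_r Cexp_0; field.
  have H1 : (Cmod (s + 1) <= M + 1)%R.
    by have := Cmod_triangle s 1; rewrite Cmod_1; lra.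
  rewrite Cmod_mult; apply: Rmult_le_compat => //; exact: Cmod_ge_0.
- apply: Rle_trans IH; rewrite Gauss_termS Cmod_mult Rmult_assoc.
  apply: Rmult_le_compat_l; first exact: Cmod_ge_0.
  have HB := Gauss_ratio_bound M s (S n) HM isT; rewrite -/K in HB.
  have HR : (Cmod (Gauss_ratio s (S n)) <= exp (K * (/ INR (S n) - / INR (S (S n)))))%R.
    have := exp_ineq1_le (K * (/ INR (S n) - / INR (S (S n)))).
    have := Cmod_triangle 1 (Gauss_ratio s (S n) - 1); rewrite Cmod_1.
    have -> : 1 + (Gauss_ratio s (S n) - 1) = Gauss_ratio s (S n) by ring.
    lra.
  have -> : (K * / INR (S n)
     = K * (/ INR (S n) - / INR (S (S n))) + K * / INR (S (S n)))%R by ring.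
  rewrite exp_plus; apply: Rmult_le_compat_r => //; exact: Rlt_le (exp_pos _).
Qed.

Lemma is_Clim_rGamma (s : C) : is_Clim (Gauss_term s) (rGamma s).
Proof.
suff [l Hl] : exists l, is_Clim (Gauss_term s) l.
  by rewrite /rGamma (Clim_seq_unique (Gauss_term s) l Hl).
suff [l Hl] : exists l, is_Clim (fun n => Gauss_term s (S n)) l.
  by exists l; apply/is_Clim_incr_1.
pose M := Cmod s; pose B := (M * (M + 1) * exp (Gauss_const M))%R.
apply: (is_Clim_telescope _ (fun n => B * Gauss_const M * / INR (S n))%R) => [n|].
- rewrite Gauss_termS.
  have -> : Gauss_term s (S n) * Gauss_ratio s (S n) - Gauss_term s (S n)
    = Gauss_term s (S n) * (Gauss_ratio s (S n) - 1) by ring.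
  rewrite Cmod_mult -Rmult_minus_distr_l Rmult_assoc.
  apply: Rmult_le_compat; try exact: Cmod_ge_0.
  + by apply: Gauss_term_bound => //; apply: Rle_refl.
  + by apply: Gauss_ratio_bound => //; apply: Rle_refl.
- have := is_lim_seq_scal_l _ (B * Gauss_const M)%R _ is_lim_seq_inv_S.
  by rewrite /= Rmult_0_r.
Qed.

Lemma rGamma_bound (M : R) : exists B, forall s, (Cmod s <= M)%R -> (Cmod (rGamma s) <= B)%R.
Proof.
exists (M * (M + 1) * exp (Gauss_const M))%R => s Hs.
apply: (is_Clim_Cmod_le _ _ _ 1 (is_Clim_rGamma s)) => n /leP Hn.
exact: Gauss_term_bound.
Qed.

Lemma rising_shift (s : C) (n : nat) : rising s (S n) = s * rising (s + 1) n.
Proof.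
elim: n => [|n IH]; first by rewrite /=; ring.
have -> : rising s (S (S n)) = rising s (S n) * (s + INR (S n)) by [].
have -> : rising (s + 1) (S n) = rising (s + 1) n * (s + 1 + INR n) by [].
by rewrite IH S_INR RtoC_plus; ring.
Qed.

(** [s] times the Gauss term at [s + 1] is the Gauss term at [s] times
    [(s + n + 1) / n], a factor that tends to 1. *)
Lemma rGammaS (s : C) : rGamma s = s * rGamma (s + 1).
Proof.
apply: (is_Clim_unique (fun n => s * Gauss_term (s + 1) (S n))); last first.
  apply: is_Clim_scal; exact: (is_Clim_incr_1 _ _).1 (is_Clim_rGamma (s + 1)).
have E n : s * Gauss_term (s + 1) (S n)
    = Gauss_term s (S n) + (s + 1) * (/ INR (S n))%R * Gauss_term s (S n).
  rewrite /Gauss_term.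
  have -> : s * (rising (s + 1) (S (S n)) /
      (INR (fact (S n)) * Cexp ((s + 1) * ln (INR (S n)))))
    = rising s (S (S (S n))) / (INR (fact (S n)) * Cexp ((s + 1) * ln (INR (S n)))).
    by rewrite (rising_shift s (S (S n))) /Cdiv; ring.
  have -> : rising s (S (S (S n))) = rising s (S (S n)) * (s + INR (S (S n))) by [].
  have H0 : (0 < INR (S n))%R by apply: lt_0_INR; apply/ltP.
  have -> : Cexp ((s + 1) * ln (INR (S n))) = Cexp (s * ln (INR (S n))) * INR (S n).
    rewrite Cmult_plus_distr_r Cexp_plus Cmult_1_l; congr Cmult.
    by rewrite /Cexp /= exp_ln // cos_0 sin_0 Rmult_1_r Rmult_0_r.
  rewrite RtoC_inv; last lra.
  rewrite (S_INR (S n)) RtoC_plus.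
  have Hf : RtoC (INR (fact (S n))) <> 0 by move=> /RtoC_inj; exact: INR_fact_neq_0.
  have HS : RtoC (INR (S n)) <> 0 by exact: RtoC_INR_neq_0.
  have He := Cexp_neq_0 (s * ln (INR (S n))).
  move: (rising s (S (S n))) Hf HS He => r.
  move: (RtoC (INR (fact (S n)))) (RtoC (INR (S n))) (Cexp _) => f m e Hf Hm He.
  by field.
apply: (filterlim_ext (fun n => Gauss_term s (S n) + (s + 1) * (/ INR (S n))%R * Gauss_term s (S n))).
  by move=> n; rewrite E.
rewrite -[X in locally X](Cplus_0_r (rGamma s)).
apply: is_Clim_plus; first exact: (is_Clim_incr_1 _ _).1 (is_Clim_rGamma s).
rewrite is_Clim_Cmod.
pose M := Cmod s; pose B := (M * (M + 1) * exp (Gauss_const M))%R.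
apply: (is_lim_seq_le_le (fun _ => 0%R) _ (fun n => Cmod (s + 1) * B * / INR (S n))%R).
- move=> n; split; first exact: Cmod_ge_0.
  rewrite /Cminus Copp_0 Cplus_0_r 2!Cmod_mult Cmod_R.
  have Hi : (0 < / INR (S n))%R by apply: Rinv_0_lt_compat; apply: lt_0_INR; apply/ltP.
  rewrite (Rabs_pos_eq (/ _)); last lra.
  have HB : (Cmod (Gauss_term s (S n)) <= B)%R by apply: Gauss_term_bound => //; apply: Rle_refl.
  have := Cmod_ge_0 (s + 1); move: (Cmod (s + 1)) (Cmod _) HB => c g HB Hc.
  have : (c * / INR (S n) * g <= c * / INR (S n) * B)%R.
    by apply: Rmult_le_compat_l => //; apply: Rmult_le_pos; lra.
  lra.
- exact: is_lim_seq_const.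
- have := is_lim_seq_scal_l _ (Cmod (s + 1) * B)%R _ is_lim_seq_inv_S.
  by rewrite /= Rmult_0_r.
Qed.

(** Each application of [rGammaS] gains a factor [|s + n| >= n + 1]. *)
Lemma rGamma_shift_bound (s : C) (n : nat) : (1 <= Re s)%R ->
  (Cmod (rGamma (s + INR n)) * INR (fact n) <= Cmod (rGamma s))%R.
Proof.
move=> Hs; elim: n => [|n IH]; first by rewrite /= Cplus_0_r Rmult_1_r; apply: Rle_refl.
apply: Rle_trans IH; rewrite (rGammaS (s + INR n)) Cmod_mult.
have -> : s + INR (S n) = s + INR n + 1 by rewrite S_INR RtoC_plus; ring.
have -> : fact (S n) = Nat.mul (S n) (fact n) by [].
rewrite mult_INR.
have : (INR (S n) <= Cmod (s + INR n))%R.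
  have := re_le_Cmod (s + INR n); have := Rle_abs (Re (s + INR n)).
  by rewrite S_INR; case: s Hs => a c /=; lra.
have := Cmod_ge_0 (rGamma (s + INR n + 1)); have := pos_INR (fact n).
move=> Hf Hg Hs'.
have := Rmult_le_compat_r _ _ _ (Rmult_le_pos _ _ Hg Hf) Hs'; lra.
Qed.

(** The left-hand side is a single term of the exponential series. *)
Lemma pow_div_fact_le_exp (t : R) (n : nat) : (0 <= t)%R -> (t ^ n / INR (fact n) <= exp t)%R.
Proof.
move=> Ht; apply: Rle_trans (exp_ge_taylor t n Ht).
case: n => [|n]; first exact: Rle_refl.
rewrite tech5; set S := sum_f_R0 _ _; suff: (0 <= S)%R by lra.
apply: cond_pos_sum => k; apply: Rdiv_le_0_compat; first exact: pow_le.
exact: INR_fact_lt_0.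
Qed.

Lemma eventually_bounded (f : nat -> R) (N : nat) (A : R) :
  (forall m, (N <= m)%nat -> (f m <= A)%R) -> exists B, forall m, (f m <= B)%R.
Proof.
elim: N A => [|N IH] A H; first by exists A => m; apply: H.
apply: (IH (Rmax A (f N))) => m; rewrite leq_eqVlt => /orP[/eqP <-|Hm].
- exact: Rmax_r.
- exact: Rle_trans (H m Hm) (Rmax_l _ _).
Qed.

(** Let [q = |y| / c + 1] and [t = q^(1/x)]. For large [m] write
    [b + m x = s + n] with [1 <= Re s < 2]; then [1 / Gamma (b + m x)] is
    [O (1 / n!)], hence [O (t^(- n))], hence [O (t^(- m x)) = O (q^(- m))],
    which beats [(|y| / c)^m]. The finitely many other [m] only change the
    constant. *)
Lemma rGamma_decay (x : R) (b y : C) (c : R) : (0 < x)%R -> (0 < c)%R ->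
  exists A, forall m : nat,
    (Cmod (y ^ m * rGamma (b + INR m * x)) <= A * c ^ m)%R.
Proof.
move=> hx hc.
pose q := (Cmod y / c + 1)%R.
have hy := Cmod_ge_0 y.
have hyc : (0 <= Cmod y / c)%R by apply: Rdiv_le_0_compat.
have hq : (1 <= q)%R by rewrite /q; lra.
have [B HB] := rGamma_bound (2 + Rabs (Im b)).
pose t := Rpower q (/ x).
have ht0 : (0 < t)%R by exact: exp_pos.
have ht1 : (1 <= t)%R.
  rewrite -(Rpower_O q); last lra.
  apply: Rle_Rpower => //; apply: Rlt_le; exact: Rinv_0_lt_compat.
have tx : (Rpower t x = q)%R by rewrite /t Rpower_mult Rinv_l ?Rpower_1; lra.
(* Beyond N0 the real part of b + m x is at least 1. *)
have [N0 [_ HN0]] := nfloor_ex (Rabs (1 - Re b) / x)%R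
  ltac:(by apply: Rdiv_le_0_compat => //; exact: Rabs_pos).
suff [A HA] : exists A, forall m, (Cmod (y ^ m * rGamma (b + INR m * x)) / c ^ m <= A)%R.
  exists A => m; have hcm := pow_lt c m hc.
  have := Rmult_le_compat_r (c ^ m) _ _ (Rlt_le _ _ hcm) (HA m).
  rewrite /Rdiv Rmult_assoc Rinv_l; lra.
apply: (eventually_bounded _ (S N0) (B * exp t * Rpower t (2 - Re b))) => m /leP /le_INR.
rewrite S_INR => Hm.
have Hmx : (1 <= Re b + INR m * x)%R.
  have : (Rabs (1 - Re b) / x * x < INR m * x)%R by apply: Rmult_lt_compat_r; lra.
  have -> : (Rabs (1 - Re b) / x * x = Rabs (1 - Re b))%R by field; lra.
  have := Rle_abs (1 - Re b); lra.
have [n [Hn1 Hn2]] := nfloor_ex (Re b + INR m * x - 1)%R ltac:(lra).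
pose s := b + (INR m * x - INR n)%R.
have Es : b + INR m * x = s + INR n by rewrite /s RtoC_minus RtoC_mult; ring.
have Hre : (1 <= Re s)%R by rewrite /s /=; move: Hn1 Hn2; rewrite /Re; lra.
have Hs : (Cmod s <= 2 + Rabs (Im b))%R.
  rewrite (surjective_pairing s); apply: Rle_trans (Cmod_le_Rabs_plus _ _) _.
  rewrite {2}/s /= Rplus_0_r; apply: Rplus_le_compat_r.
  by rewrite Rabs_pos_eq; move: Hre; rewrite /Re; move: Hn1 Hn2; rewrite /s /Re /=; lra.
have HG := rGamma_shift_bound s n Hre; rewrite -Es in HG.
have HBs := HB s Hs; have HB0 : (0 <= B)%R by apply: Rle_trans HBs; exact: Cmod_ge_0.
have Hf := INR_fact_lt_0 n.
have Htn : (0 < t ^ n)%R by exact: pow_lt.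
have He := pow_div_fact_le_exp t n (Rlt_le _ _ ht0).
have Hqm : (q ^ m <= t ^ n * Rpower t (2 - Re b))%R.
  rewrite -tx -Rpower_pow; last exact: exp_pos.
  rewrite Rpower_mult -Rpower_pow // -Rpower_plus.
  by apply: Rle_Rpower => //; lra.
have Hyq : (Cmod y ^ m / c ^ m <= q ^ m)%R.
  rewrite /Rdiv -pow_inv -Rpow_mult_distr.
  by apply: pow_incr; rewrite /q; lra.
have HP : (0 < Rpower t (2 - Re b))%R by exact: exp_pos.
rewrite Cmod_mult Cmod_pow.
set G := Cmod (rGamma _) in HG *.
have HG0 : (0 <= G)%R by exact: Cmod_ge_0.
have HGt : (G * t ^ n <= B * exp t)%R.
  have -> : (G * t ^ n = (G * INR (fact n)) * (t ^ n / INR (fact n)))%R by field; lra.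
  apply: Rmult_le_compat; [nra| |lra|lra].
  by apply: Rdiv_le_0_compat; lra.
have -> : (Cmod y ^ m * G / c ^ m = (Cmod y ^ m / c ^ m) * G)%R by rewrite /Rdiv; ring.
apply: (Rle_trans _ ((t ^ n * Rpower t (2 - Re b)) * G)).
  by apply: Rmult_le_compat_r => //; lra.
have -> : (t ^ n * Rpower t (2 - Re b) * G = G * t ^ n * Rpower t (2 - Re b))%R by ring.
by apply: Rmult_le_compat_r => //; lra.
Qed.

(** * Divisor sums of the Moebius function *)

(** Makes the generic lemmas on iterated operators apply to sums of complex
    numbers. *)
HB.instance Definition _ :=
  Monoid.isComLaw.Build C (RtoC 0) Cplus Cplus_assoc Cplus_comm Cplus_0_l.

Lemma mobius_mul_prime (p e : nat) : prime p -> (0 < e)%nat -> ~~ (p %| e)%nat ->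
  mobius (p * e)%nat = (- mobius e)%R.
Proof.
move=> pp e0 pe; have p0 := prime_gt0 pp.
have pe' : p \notin primes e by rewrite mem_primes pp e0.
have P : perm_eq (primes (p * e)) (p :: primes e).
  apply: uniq_perm => [||q]; rewrite /= ?pe' ?primes_uniq //.
  by rewrite primesM // inE primes_prime // inE.
rewrite /mobius (perm_all _ P) (perm_size P) /=.
have -> : logn p (p * e) == 1%nat.
  by rewrite lognM // logn_prime // eqxx lognE (negbTE pe) andbF andbF.
rewrite /= (@eq_in_all _ _ (fun q : nat => logn q e == 1%nat)); last first.
  move=> q qe /=; rewrite lognM // logn_prime //.
  by case: (q =P p) => // Eq; case/negP: pe'; rewrite -Eq.
case: all; ring.
Qed.

Lemma mobius_not_squarefree (p d : nat) : prime p -> (0 < d)%nat -> (p * p %| d)%nat ->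
  mobius d = 0%R.
Proof.
move=> pp d0 ppd; have p0 := prime_gt0 pp; rewrite /mobius.
case: allP => // /(_ p) H; exfalso.
have pd : (p %| d)%nat by apply: dvdn_trans ppd; exact: dvdn_mulr.
have /H /eqP : p \in primes d by rewrite mem_primes pp d0.
by apply/eqP; rewrite neq_ltn -(pfactor_dvdn 2) // ppd orbT.
Qed.

Lemma Rabs_mobius_le_1 (n : nat) : (Rabs (mobius n) <= 1)%R.
Proof.
rewrite /mobius; case: all; last by rewrite Rabs_R0; lra.
by rewrite pow_1_abs; lra.
Qed.

(** Let [p] be a prime divisor of [m > 1]. Divisors divisible by [p^2]
    contribute 0, and the others pair up as [d] and [p d] with [p] not dividing
    [d]; these two have opposite values of the Moebius function. *)
Lemma sum_mobius_divisors (m : nat) : (0 < m)%nat ->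
  \big[Cplus/RtoC 0]_(d <- divisors m) RtoC (mobius d) = RtoC (if m == 1%nat then 1 else 0)%R.
Proof.
move=> m0; case: eqP => [->|/eqP m1].
  by rewrite big_seq1.
have pp : prime (pdiv m) by apply: pdiv_prime; rewrite ltn_neqAle eq_sym m1.
have := pdiv_dvd m; move: (pdiv m) pp => p pp pm; have p0 := prime_gt0 pp.
(* Divisors prime to p first, multiples of p second. *)
rewrite (bigID (fun d => ~~ (p %| d)%nat)) /=.
have -> : \big[Cplus/RtoC 0]_(d <- divisors m | ~~ ~~ (p %| d)%nat) RtoC (mobius d)
  = \big[Cplus/RtoC 0]_(d <- divisors m | (p %| d)%nat && ~~ (p * p %| d)%nat) RtoC (mobius d).
  rewrite (bigID (fun d => ~~ (p * p %| d)%nat)) /= [X in _ + X = _]big1_seq ?Cplus_0_r.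
    by apply: eq_bigl => d; rewrite negbK.
  move=> d /andP[/andP[_]]; rewrite negbK => ppd; rewrite -dvdn_divisors // => dm.
  by rewrite (mobius_not_squarefree p d) // (dvdn_gt0 m0 dm).
have P : perm_eq [seq d <- divisors m | (p %| d)%nat && ~~ (p * p %| d)%nat]
                 [seq (p * d)%nat | d <- divisors m & ~~ (p %| d)%nat].
  apply: uniq_perm; first by rewrite filter_uniq ?divisors_uniq.
    rewrite map_inj_uniq ?filter_uniq ?divisors_uniq // => u v /eqP.
    by rewrite eqn_pmul2l // => /eqP.
  move=> d; rewrite mem_filter -dvdn_divisors //; apply/idP/mapP.
  - case/andP => /andP[pd ppd] dm.
    have E : d = (p * (d %/ p))%nat by rewrite mulnC divnK.
    exists (d %/ p)%nat => //; rewrite mem_filter -dvdn_divisors //.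
    have <- : (p * p %| p * (d %/ p))%nat = (p %| d %/ p)%nat by rewrite dvdn_pmul2l.
    rewrite -E ppd /=.
    by apply: dvdn_trans dm; rewrite {2}E dvdn_mull.
  - case=> e; rewrite mem_filter -dvdn_divisors // => /andP[pe em] ->.
    rewrite dvdn_mulr // dvdn_pmul2l // pe /= Gauss_dvd ?pm //.
    by rewrite prime_coprime.
rewrite -(big_filter _ (fun d => (p %| d)%nat && _)) (perm_big _ P) big_map big_filter.
rewrite -big_split /= big1_seq // => d; rewrite -dvdn_divisors // => /andP[pd dm].
rewrite mobius_mul_prime // ?(dvdn_gt0 m0 dm) //.
by rewrite RtoC_opp Cplus_opp_r.
Qed.

Lemma sum_mobius_upto (N m : nat) : (0 < m <= N)%nat ->
  \big[Cplus/RtoC 0]_(1 <= n < N.+1 | (n %| m)%nat) RtoC (mobius n)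
  = RtoC (if m == 1%nat then 1 else 0)%R.
Proof.
case/andP=> m0 mN; rewrite -sum_mobius_divisors // -big_filter; apply: perm_big.
apply: uniq_perm; rewrite ?filter_uniq ?iota_uniq ?divisors_uniq // => d.
rewrite mem_filter mem_index_iota -dvdn_divisors //; case: (boolP (d %| m)%nat) => //= dm.
by rewrite (dvdn_gt0 m0 dm) ltnS (leq_trans (dvdn_leq m0 dm) mN).
Qed.

(** * Moebius inversion of series *)

Lemma sum_n_big (u : nat -> C) (N : nat) :
  sum_n u N = \big[Cplus/RtoC 0]_(0 <= k < N.+1) u k.
Proof.
elim: N => [|N IH]; first by rewrite sum_O big_nat1.
by rewrite sum_Sn IH [in RHS]big_nat_recr.
Qed.

Lemma is_Clim_big (r : seq nat) (F : nat -> nat -> C) (l : nat -> C) :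
  (forall n, n \in r -> is_Clim (F n) (l n)) ->
  is_Clim (fun L => \big[Cplus/RtoC 0]_(n <- r) F n L) (\big[Cplus/RtoC 0]_(n <- r) l n).
Proof.
elim: r => [|a r IH] H.
  rewrite big_nil; apply: (filterlim_ext (fun _ => RtoC 0)); last exact: is_Clim_const.
  by move=> L; rewrite big_nil.
rewrite big_cons; apply: (filterlim_ext (fun L => F a L + \big[Cplus/RtoC 0]_(n <- r) F n L)).
  by move=> L; rewrite big_cons.
apply: is_Clim_plus; first by apply: H; rewrite mem_head.
by apply: IH => n nr; apply: H; rewrite inE nr orbT.
Qed.

(** Increasing [L] by one adds a term on either side exactly when [n] divides
    [L + 1]. *)
Lemma sum_multiples (g : nat -> C) (n L : nat) : (0 < n)%nat ->
  \big[Cplus/RtoC 0]_(0 <= k < L %/ n) g (n * k.+1)%nat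
  = \big[Cplus/RtoC 0]_(1 <= m < L.+1 | (n %| m)%nat) g m.
Proof.
move=> n0; elim: L => [|L IH]; first by rewrite div0n !big_geq.
rewrite [in RHS]big_mkcond big_nat_recr //= -big_mkcond -IH divnS //.
case: (boolP (n %| L.+1)%nat) => nL; last by rewrite add0n Monoid.mulm1.
have E : (n * (L %/ n).+1 = L.+1)%nat.
  by have := divnS L n0; rewrite nL add1n => <-; rewrite mulnC divnK.
by rewrite add1n big_nat_recr //= E.
Qed.

(** Ordering the truncation by [m = n k <= L] lets the series for different [n]
    be truncated at the same point. *)
Lemma is_Clim_multiples (g : nat -> C) (n : nat) (E : C) : (0 < n)%nat ->
  is_Cseries (fun k => g (n * k.+1)%nat) E ->
  is_Clim (fun L => \big[Cplus/RtoC 0]_(1 <= m < L.+1 | (n %| m)%nat) g m) E.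
Proof.
move=> n0 HE.
have H : is_Clim (fun L => \big[Cplus/RtoC 0]_(0 <= k < L) g (n * k.+1)%nat) E.
  apply/is_Clim_incr_1; apply: filterlim_ext HE => L; exact: sum_n_big.
apply: (filterlim_ext (fun L => \big[Cplus/RtoC 0]_(0 <= k < L %/ n) g (n * k.+1)%nat)).
  by move=> L; apply: sum_multiples.
apply: (filterlim_comp _ _ _ (fun L => L %/ n)%nat _ _ _ _ _ H) => P [K HK].
exists (K * n)%nat => L /leP KL; apply: HK; apply/leP.
by rewrite leq_divRL.
Qed.

Lemma Cmod_big_le (F : nat -> C) (v : nat -> R) (a L : nat) : (a <= L.+1)%nat ->
  (forall m, (a <= m)%nat -> (Cmod (F m) <= v m)%R) ->
  (Cmod (\big[Cplus/RtoC 0]_(a <= m < L.+1) F m) <= sum_n_m v a L)%R.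
Proof.
move=> aL HF.
have base : forall K, K = a -> (Cmod (\big[Cplus/RtoC 0]_(a <= m < K) F m) <= 0)%R.
  by move=> K ->; rewrite big_geq // Cmod_0; apply: Rle_refl.
elim: L aL => [|L IH].
  rewrite leq_eqVlt => /orP[/eqP E|].
    by rewrite sum_n_m_zero; [exact: base|rewrite E; apply/ltP].
  case: a HF base => // HF _ _; rewrite big_nat1 sum_n_n; exact: HF.
rewrite leq_eqVlt => /orP[/eqP E|aL].
  by rewrite sum_n_m_zero; [exact: base|rewrite E; apply/ltP].
rewrite big_nat_recr //= sum_n_Sm; last by apply/leP.
apply: Rle_trans (Cmod_triangle _ _) _.
by apply: Rplus_le_compat; [exact: IH|exact: HF].
Qed.

Lemma Cmod_sum_mobius_le (P : pred nat) (N : nat) :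
  (Cmod (\big[Cplus/RtoC 0]_(1 <= n < N.+1 | P n) RtoC (mobius n)) <= INR N)%R.
Proof.
elim: N => [|N IH]; first by rewrite big_geq // Cmod_0; exact: Rle_refl.
rewrite S_INR big_mkcond big_nat_recr //= -big_mkcond.
apply: Rle_trans (Cmod_triangle _ _) _; apply: Rplus_le_compat => //.
case: (P _); last by rewrite Cmod_0; lra.
rewrite Cmod_R; exact: Rabs_mobius_le_1.
Qed.

Lemma exchange_sum_multiples (g : nat -> C) (N L : nat) :
  \big[Cplus/RtoC 0]_(1 <= n < N.+1)
     (mobius n * \big[Cplus/RtoC 0]_(1 <= m < L.+1 | (n %| m)%nat) g m)
  = \big[Cplus/RtoC 0]_(1 <= m < L.+1)
     ((\big[Cplus/RtoC 0]_(1 <= n < N.+1 | (n %| m)%nat) RtoC (mobius n)) * g m).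
Proof.
under eq_bigr => n _ do
  rewrite (big_morph (Cmult (mobius n)) (Cmult_plus_distr_l _) (Cmult_0_r _)).
under [in RHS]eq_bigr => m _ do
  rewrite (big_morph (fun c => c * g m) (fun x y => Cmult_plus_distr_r x y (g m)) (Cmult_0_l _)).
exact: exchange_big_dep.
Qed.

(** The factor [m] in the hypothesis bounds the number of divisors of [m], and
    with it any partial sum of the Moebius function over them. *)
Lemma mobius_series_inversion (g E : nat -> C) :
  ex_series (fun m => INR m * Cmod (g m))%R ->
  (forall n, (0 < n)%nat -> is_Cseries (fun k => g (n * k.+1)%nat) (E n)) ->
  is_Cseries (fun k => mobius k.+1 * E k.+1) (g 1%nat).
Proof.
move=> Hg HE; apply/is_Clim_Cmod; apply/is_lim_seq_spec => eps.
have [N0 HN0] := Cauchy_ex_series _ Hg (pos_div_2 eps).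
exists N0 => N /leP HN; rewrite Rminus_0_r Rabs_pos_eq; last exact: Cmod_ge_0.
apply: (Rle_lt_trans _ (eps / 2)); last by have := cond_pos eps; lra.
rewrite sum_n_big -(big_add1 _ _ 0 N.+2 xpredT (fun n => mobius n * E n)).
apply: (is_Clim_Cmod_le
  (fun L => \big[Cplus/RtoC 0]_(1 <= n < N.+2)
     (mobius n * \big[Cplus/RtoC 0]_(1 <= m < L.+1 | (n %| m)%nat) g m) - g 1%nat) _ _ N.+1).
  apply: is_Clim_plus (is_Clim_const _); apply: is_Clim_big => n.
  rewrite mem_index_iota => /andP[n0 _].
  by apply: is_Clim_scal; apply: is_Clim_multiples => //; apply: HE.
move=> L /leP NL; rewrite exchange_sum_multiples (big_cat_nat (n := N.+2)) //=.
(* For m <= N + 1 every divisor of m is among the indices n, so the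
   coefficients are complete divisor sums. *)
have -> : \big[Cplus/RtoC 0]_(1 <= m < N.+2)
   ((\big[Cplus/RtoC 0]_(1 <= n < N.+2 | (n %| m)%nat) RtoC (mobius n)) * g m) = g 1%nat.
  rewrite big_ltn // sum_mobius_upto //= Cmult_1_l big1_seq ?Cplus_0_r // => m /=.
  rewrite mem_index_iota => /andP[m1 mN].
  by rewrite sum_mobius_upto ?(ltnW m1) // gtn_eqF // Cmult_0_l.
set T := \big[_/_]_(_ <= _ < _) _.
have -> : g 1%nat + T - g 1%nat = T by ring.
apply: Rlt_le; apply: Rle_lt_trans (HN0 N.+2 L _ _); last first.
- by apply/leP; apply: leq_trans HN (ltnW NL).
- by apply/leP; apply: leq_trans HN (leqW (leqnSn _)).
apply: Rle_trans (Rle_abs _); rewrite /T; apply: Cmod_big_le => // m Nm.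
rewrite Cmod_mult; apply: Rmult_le_compat_r; first exact: Cmod_ge_0.
apply: Rle_trans (Cmod_sum_mobius_le _ _) _.
by apply: le_INR; apply/leP; exact: ltnW.
Qed.

(** * Mittag-Leffler series *)

Lemma ex_series_INR_mul_geom (v : nat -> R) (A : R) :
  (forall m, (0 <= v m <= A * (/ 4) ^ m)%R) -> ex_series (fun m => INR m * v m)%R.
Proof.
move=> Hv; apply: (@ex_series_le R_AbsRing R_CompleteNormedModule _ (fun m => A * (/ 2) ^ m)%R).
  move=> m; have [H0 HA] := Hv m; rewrite /norm /= /abs /= Rabs_pos_eq; last first.
    by apply: Rmult_le_pos => //; exact: pos_INR.
  have Hm : (INR m <= 2 ^ m)%R.
    elim: m {H0 HA} => [|m IH]; first by rewrite /=; lra.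
    have : (1 <= 2 ^ m)%R by apply: pow_R1_Rle; lra.
    rewrite S_INR -tech_pow_Rmult; lra.
  have -> : (A * (/ 2) ^ m = 2 ^ m * (A * (/ 4) ^ m))%R.
    have -> : (/ 2 = 2 * / 4)%R by lra.
    by rewrite Rpow_mult_distr; ring.
  by apply: Rmult_le_compat => //; exact: pos_INR.
apply: (@ex_series_scal R_AbsRing R_NormedModule); exists (/ (1 - / 2))%R.
by apply: is_series_geom; rewrite Rabs_pos_eq; lra.
Qed.

Lemma is_Cseries_MittagLeffler (x : R) (b y : C) (n : nat) : (0 < x)%R -> (0 < n)%nat ->
  is_Cseries (fun k => y ^ (n * k.+1)%nat * rGamma (b + INR (n * k.+1)%nat * x))
    (MittagLeffler (INR n * x) b (y ^ n) - rGamma b).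
Proof.
move=> hx n0.
pose a k := y ^ (n * k)%nat * rGamma (b + INR (n * k)%nat * x).
have Ea : forall k, a k = (y ^ n) ^ k * rGamma (b + INR n * x * INR k).
  move=> k; rewrite /a Cpow_mult_r mult_INR RtoC_mult.
  by congr (_ * rGamma (_ + _)); ring.
have [A HA] := rGamma_decay x b y (/ 2) hx ltac:(lra).
have HA0 : (0 <= A)%R.
  by have := HA 0%nat; rewrite Rmult_1_r; apply: Rle_trans; exact: Cmod_ge_0.
(* [MittagLeffler] is the sum of its series only once that series is known to
   converge. *)
have [l Hl] : exists l, is_Cseries a l.
  apply: (ex_Cseries_le a (fun k => A * (/ 2) ^ k)%R) => [k|].
    apply: Rle_trans (HA _) _; apply: Rmult_le_compat_l => //.
    rewrite !pow_inv; apply: Rinv_le_contravar; first by apply: pow_lt; lra.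
    by apply: Rle_pow; [lra|apply/leP; rewrite leq_pmull].
  apply: (@ex_series_scal R_AbsRing R_NormedModule); exists (/ (1 - / 2))%R.
  by apply: is_series_geom; rewrite Rabs_pos_eq; lra.
have EM : MittagLeffler (INR n * x) b (y ^ n) = l.
  apply: Cseries_unique; apply: filterlim_ext Hl => N.
  by apply: sum_n_ext => k; apply: Ea.
rewrite EM; apply: (@is_series_incr_1 C_AbsRing C_NormedModule a).
suff -> : plus (l - rGamma b) (a 0%nat) = l by [].
rewrite Ea /= Cmult_0_r Cplus_0_r Cmult_1_l; change (l - rGamma b + rGamma b = l); ring.
Qed.

Theorem mainTheorem5 (x : R) (b z logz : C)
  (hx : (0 < x)%R) (hz : z <> RtoC 0) (hlogz : Cexp logz = z) :
  is_Cseries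
    (fun k : nat =>
       mobius (S k)
       * (MittagLeffler (INR (S k) * x) b (Cpower_log logz (INR (S k) * x))
          - rGamma b))
    (Cpower_log logz x * rGamma (b + x))
  /\
  (forall y : C, y = Cpower_log logz x ->
   is_Cseries
     (fun k : nat =>
        mobius (S k) * (MittagLeffler (INR (S k) * x) b (y ^ S k) - rGamma b))
     (y * rGamma (b + x))).
Proof.
have H : forall y : C, is_Cseries
     (fun k : nat =>
        mobius (S k) * (MittagLeffler (INR (S k) * x) b (y ^ S k) - rGamma b))
     (y * rGamma (b + x)).
  move=> y; pose g m := y ^ m * rGamma (b + INR m * x).
  have -> : y * rGamma (b + x) = g 1%nat by rewrite /g /= Cmult_1_r Cmult_1_l.
  apply: (mobius_series_inversion g
    (fun n => MittagLeffler (INR n * x) b (y ^ n) - rGamma b)) => [|n n0].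
    have [A HA] := rGamma_decay x b y (/ 4) hx ltac:(lra).
    by apply: (ex_series_INR_mul_geom _ A) => m; split; [exact: Cmod_ge_0|exact: HA].
  exact: is_Cseries_MittagLeffler.
split=> [|y _]; last exact: H.
apply: filterlim_ext (H (Cpower_log logz x)) => N; apply: sum_n_ext => k.
rewrite /Cpower_log -Cexp_pow; congr (_ * (MittagLeffler _ _ (Cexp _) - _)); ring.
Qed.
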